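(* Let $p,q\in\mathbb C$ with $p+q=1$. If $p$ is not real, then the quantum vector pre-measure $\mu_{\mathsf v}$ of complex percolation with parameter $p$ is not of bounded variation.
   Context: Labelled causal sets: an $n$-element labelled causal set $C^n$ is a strict partial order $\prec$ on $\{1,\dots,n\}$ such that $i\prec j$ implies $i<j$. Two elements are linked if they are related and no element lies strictly between them. $\Omega$ is the set of infinite labelled causal sets, i.e. strict partial orders on $\{1,2,3,\dots\}$ with $i\prec j\Rightarrow i<j$ (these are automatically past finite). $\mathrm{cyl}(C^n)\subset\Omega$ is the set of $c\in\Omega$ whose restriction to $\{1,\dots,n\}$ is $C^n$. $\mathfrak A$ is the algebra of all finite unions of such cylinder sets; each element is a finite disjoint union of cylinder sets. Complex percolation with parameter $p\in\mathbb C$, $q=1-p$: if $C^{n+1}$ restricts to $C^n$ and its new element $n+1$ is linked to exactly $u$ elements of $C^n$ and unrelated to exactly $v$ elements of $C^n$, the transition amplitude is $p^uq^v$ (convention $0^0=1$). The amplitude $A(C^n)$ is the product of the transition amplitudes starting from the one-element causal set (with amplitude $1$); equivalently $A(C^n)=p^Lq^{\binom n2-R}$ with $L$ the number of links and $R$ the number of relations of $C^n$. Setting $A(\mathrm{cyl}(C^n))=A(C^n)$ defines a finitely additive $A:\mathfrak A\to\mathbb C$ with $A(\Omega)=1$, and the decoherence functional is $D(\alpha,\beta)=A^*(\alpha)A(\beta)$. Histories Hilbert space: let $V$ be the space of finitely supported functions $u:\mathfrak A\to\mathbb C$ with $\langle u,v\rangle_V=\sum_{\alpha,\beta}u^*(\alpha)v(\beta)D(\alpha,\beta)$;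 $\mathcal H$ is the Hilbert space of Cauchy sequences in $V$ modulo $\{u_i\}\sim\{v_i\}$ iff $\|u_i-v_i\|_V\to0$. The quantum vector pre-measure is $\mu_{\mathsf v}(\alpha)=[\chi_\alpha]\in\mathcal H$, with $\chi_\alpha\in V$ equal to $1$ at $\alpha$ and $0$ elsewhere; it is finitely additive and $\langle\mu_{\mathsf v}(\alpha),\mu_{\mathsf v}(\beta)\rangle=D(\alpha,\beta)$. (Here $\mathcal H\simeq\mathbb C$ and $\mu_{\mathsf v}$ equals $A$ up to a phase.) Total variation: $|\mu_{\mathsf v}|(\alpha)=\sup\sum_\rho\|\mu_{\mathsf v}(\alpha_\rho)\|$ over finite partitions $\{\alpha_\rho\}\subset\mathfrak A$ of $\alpha$; $\mu_{\mathsf v}$ is of bounded variation if $|\mu_{\mathsf v}|(\alpha)<\infty$ for all $\alpha\in\mathfrak A$. *)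

(* Defs.v *)
From HB Require Import structures.
From mathcomp Require Import all_boot all_order all_algebra.
From mathcomp Require Import finmap complex generic_quotient.
From mathcomp Require Import ring.
From mathcomp Require Import all_classical all_reals all_analysis.

Set Implicit Arguments.
Unset Strict Implicit.
Unset Printing Implicit Defensive.

Import Order.TTheory GRing.Theory Num.Theory.
Import numFieldNormedType.Exports.

Local Open Scope classical_set_scope.
Local Open Scope ring_scope.
Local Open Scope quotient_scope.

(* The labels 1, 2, 3, ... are shifted to 0, 1, 2, ..., so an n-element
   labelled causal set lives on 'I_n and an infinite one on nat. *)

Definition is_causet (n : nat) (r : rel 'I_n) : bool :=
  [&& [forall i, ~~ r i i],
      [forall i, forall j, forall k, r i j ==> r j k ==> r i k]
    & [forall i, forall j, r i j ==> (i < j)%N]].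

Record causet (n : nat) := Causet {
  causet_rel :> {set 'I_n * 'I_n};
  causetP : is_causet (fun i j => (i, j) \in causet_rel) }.

HB.instance Definition _ n := [isSub for @causet_rel n].
HB.instance Definition _ n := [Finite of causet n by <:].

Section Causet.
Variables (n : nat) (C : causet n).
Implicit Types i j k : 'I_n.

Definition prec i j : bool := (i, j) \in causet_rel C.
Definition related i j : bool := prec i j || prec j i.
Definition linked i j : bool :=
  related i j && ~~ [exists k, (prec i k && prec k j) || (prec j k && prec k i)].

End Causet.

Definition restrict_rel (n : nat) (C : causet n.+1) : {set 'I_n * 'I_n} :=
  [set x : 'I_n * 'I_n |
    prec C (widen_ord (leqnSn n) x.1) (widen_ord (leqnSn n) x.2)].

Lemma restrict_causet (n : nat) (C : causet n.+1) :
  is_causet (fun i j => (i, j) \in restrict_rel C).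
Proof.
have /and3P[/forallP r_irr /forallP r_tr /forallP r_nat] := causetP C.
apply/and3P; split; apply/forallP => i.
- by rewrite inE; exact: r_irr.
- apply/forallP => j; apply/forallP => k; rewrite !inE.
  have /forallP/(_ (widen_ord (leqnSn n) j)) := r_tr (widen_ord (leqnSn n) i).
  by move/forallP/(_ (widen_ord (leqnSn n) k)).
- apply/forallP => j; rewrite inE.
  by have /forallP/(_ (widen_ord (leqnSn n) j)) := r_nat (widen_ord (leqnSn n) i).
Qed.

Definition restrict (n : nat) (C : causet n.+1) : causet n :=
  Causet (restrict_causet C).

Record Omega := MkOmega {
  oprec :> nat -> nat -> Prop;
  oprec_irr : forall i, ~ oprec i i;
  oprec_trans : forall i j k, oprec i j -> oprec j k -> oprec i k;
  oprec_natural : forall i j, oprec i j -> (i < j)%N }.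

Definition cyl (n : nat) (C : causet n) : set Omega :=
  [set c : Omega | forall i j : 'I_n, c i j <-> prec C i j].

(* The finite causal sets of all sizes. The empty one is harmless: its
   cylinder set is Omega, like that of the one-element causal set, and both
   have amplitude 1. *)
Definition fin_causet : Type := {n : nat & causet n}.

Definition tcyl (C : fin_causet) : set Omega := cyl (tagged C).

Definition cyl_algebra : set (set Omega) :=
  [set a | exists s : seq fin_causet, a = \bigcup_(C in [set` s]) tcyl C].

Definition event : Type := set_type cyl_algebra.
HB.instance Definition _ := Choice.on event.

Definition decomposition (a : set Omega) (s : seq fin_causet) : Prop :=
  uniq s /\ partition [set` s] tcyl a.

Section Percolation.
Variables (R : realType) (p q : R[i]).

(* Transition amplitude from [restrict C] to C; the new element is ord_max. *)
Definition transition (n : nat) (C : causet n.+1) : R[i] :=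
  p ^+ #|[set i : 'I_n.+1 | linked C i ord_max]| *
  q ^+ #|[set i : 'I_n.+1 | (i != ord_max) && ~~ related C i ord_max]|.

(* The factor for n = 0 is p ^+ 0 * q ^+ 0 = 1, so the one-element causal set
   has amplitude 1. *)
Fixpoint amplitude (n : nat) : causet n -> R[i] :=
  match n with
  | 0 => fun=> 1
  | m.+1 => fun C => amplitude (restrict C) * transition C
  end.

(* Every event has a decomposition and, when p + q = 1, the sum does not depend
   on the one chosen by xget: it is the finitely additive extension of
   cyl C |-> amplitude C. *)
Definition ampl (a : event) : R[i] :=
  \sum_(C <- xget [::] (decomposition (set_val a))) amplitude (tagged C).

Definition decoherence (a b : event) : R[i] := (ampl a)^* * ampl b.

End Percolation.

Section FinSupp.
Variable R : realType.

(* R[i]^o is R[i] with its lmodType and normed-space structures over R[i]. *)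
Definition finsupp_pred : {pred event -> R[i]^o} :=
  fun u => `[< finite_set [set a | u a != 0] >].

Lemma finsupp_submod_closed : submod_closed finsupp_pred.
Proof.
split.
  by apply/asboolP; apply: (@sub_finite_set _ _ set0) => // a /= /eqP.
move=> k u v /asboolP u_fin /asboolP v_fin; apply/asboolP.
apply: (@sub_finite_set _ _ ([set a | u a != 0] `|` [set a | v a != 0])).
  move=> a /= kuv; apply/orP; apply: contraNT kuv.
  rewrite negb_or !negbK => /andP[/eqP u0 /eqP v0].
  by rewrite !fctE u0 v0 scaler0 addr0.
by rewrite finite_setU.
Qed.
HB.instance Definition _ :=
  GRing.isSubmodClosed.Build R[i] (event -> R[i]^o) finsupp_pred
    finsupp_submod_closed.

Record V := MkV {
  Vfun :> event -> R[i]^o;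
  Vfun_finsupp : Vfun \in finsupp_pred }.
HB.instance Definition _ := [isSub for Vfun].
HB.instance Definition _ := [Choice of V by <:].
HB.instance Definition _ := [SubChoice_isSubLmodule of V by <:].

Definition chi_fun (a b : event) : R[i]^o := (b == a)%:R.

Lemma chi_finsupp (a : event) : chi_fun a \in finsupp_pred.
Proof.
apply/asboolP; apply: (@sub_finite_set _ _ [set a]) => // b /=.
by rewrite /chi_fun; case: (b =P a) => // _; rewrite eqxx.
Qed.

Definition chi (a : event) : V := MkV (chi_finsupp a).

End FinSupp.

Section HistoriesHilbertSpace.
Variables (R : realType) (p q : R[i]).
Local Notation D := (decoherence p q).

Definition innerV (u v : V R) : R[i] :=
  \sum_(a \in [set: event]) \sum_(b \in [set: event]) (u a)^* * v b * D a b.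

Definition normV (u : V R) : R := Num.sqrt (complex.Re (innerV u u)).

Definition cauchyV (u : nat -> V R) : Prop :=
  forall e : R, 0 < e ->
    exists N : nat, forall m n, (N <= m)%N -> (N <= n)%N -> normV (u m - u n) < e.

Definition equivV (u v : nat -> V R) : Prop :=
  normV (u i - v i) @[i --> \oo] --> (0 : R).

(* innerV u v = (amplV u)^* * amplV v, so H has dimension at most 1. *)
Definition amplV (u : V R) : R[i] := \sum_(a \in [set: event]) u a * ampl p q a.

Definition suppV (u : V R) : seq event := fset_set [set a | u a != 0].

Lemma fsum_supp (u : V R) (s : seq event) (f : event -> R[i]) :
    uniq s -> {subset suppV u <= s} -> (forall a, u a = 0 -> f a = 0) ->
  \sum_(a \in [set: event]) f a = \sum_(a <- s) f a.
Proof.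
move=> s_uniq us f0; rewrite (fsbigE s) //.
  by apply: eq_bigl => a; rewrite in_setT.
move=> a _ /negP a_s; apply: f0; apply/eqP; rewrite -[_ == _]negbK.
apply/negP => ua; apply: a_s; apply: us.
by rewrite /suppV in_fset_set ?inE //; exact/asboolP/Vfun_finsupp.
Qed.

Lemma innerVE u v : innerV u v = (amplV u)^* * amplV v.
Proof.
rewrite /innerV /amplV.
have supp_u : uniq (suppV u) by exact: fset_uniq.
rewrite [in RHS](@fsum_supp u (suppV u)) //; last first.
  by move=> a ->; rewrite mul0r.
rewrite rmorph_sum mulr_suml (@fsum_supp u (suppV u)) //; last first.
  by move=> a ua; apply: fsbig1 => b _; rewrite ua conjC0 !mul0r.
apply: eq_bigr => a _; rewrite mulr_fsumr; apply: eq_fsbigr => b _.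
by rewrite /decoherence rmorphM /=; ring.
Qed.

Lemma amplVB u v : amplV (u - v) = amplV u - amplV v.
Proof.
pose s := undup (suppV u ++ suppV v ++ suppV (u - v)).
have s_uniq : uniq s by exact: undup_uniq.
have su : {subset suppV u <= s} by move=> a; rewrite mem_undup mem_cat => ->.
have sv : {subset suppV v <= s}.
  by move=> a; rewrite mem_undup !mem_cat => ->; rewrite orbT.
have suv : {subset suppV (u - v) <= s}.
  by move=> a; rewrite mem_undup !mem_cat => ->; rewrite !orbT.
rewrite /amplV (fsum_supp s_uniq suv); last by move=> a ->; rewrite mul0r.
rewrite (fsum_supp s_uniq su); last by move=> a ->; rewrite mul0r.
rewrite (fsum_supp s_uniq sv); last by move=> a ->; rewrite mul0r.
by rewrite -sumrB; apply: eq_bigr => a _; rewrite -mulrBl.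
Qed.

Lemma normVE u : (normV u)%:C%C = `|amplV u|.
Proof.
have := normCK (amplV u); rewrite mulrC -innerVE => Lu.
have [r Lr] : exists r : R, `|amplV u| = r%:C%C.
  by case: (amplV u) => x y; eexists; rewrite normc_def.
rewrite /normV -Lu Lr -rmorphXn /= sqrtr_sqr ger0_norm //.
by have := normr_ge0 (amplV u); rewrite Lr lecE /= eqxx.
Qed.

Lemma normV_sub_sym u v : normV (u - v) = normV (v - u).
Proof.
by apply: (@complexI R); rewrite !normVE !amplVB distrC.
Qed.

Lemma normV_triangle u v w : normV (u - w) <= normV (u - v) + normV (v - w).
Proof. by rewrite -lecR rmorphD /= !normVE !amplVB ler_distD. Qed.

Lemma normV0 u : normV (u - u) = 0.
Proof. by apply: (@complexI R); rewrite normVE amplVB subrr normr0. Qed.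

Record cauchy_sequence := CauchySequence {
  cauchy_fun :> nat -> V R;
  cauchy_funP : `[< cauchyV cauchy_fun >] }.
HB.instance Definition _ := [isSub for cauchy_fun].
HB.instance Definition _ := [Choice of cauchy_sequence by <:].

Definition equivb (u v : cauchy_sequence) : bool := `[< equivV u v >].

Lemma equivb_equiv : equiv_class_of equivb.
Proof.
split.
- move=> u; apply/asboolP; rewrite /equivV.
  by under eq_fun do rewrite normV0; exact: cvg_cst.
- move=> u v; apply/asbool_equiv_eq; rewrite /equivV.
  by under eq_fun do rewrite normV_sub_sym.
- move=> v u w /asboolP uv /asboolP vw; apply/asboolP; rewrite /equivV.
  apply: (@squeeze_cvgr _ _ _ _ (fun=> 0)
      (fun i => normV (u i - v i) + normV (v i - w i))).
  + by near=> i; rewrite sqrtr_ge0 normV_triangle.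
  + exact: cvg_cst.
  + by rewrite -[0]addr0; exact: cvgD.
Unshelve. all: by end_near.
Qed.

Canonical equivb_rel := EquivRelPack equivb_equiv.

(* Cauchy sequences of V modulo the sequences of norm tending to 0 *)
Definition H : Type := {eq_quot equivb}.

(* The limit exists and does not depend on the representatives. *)
Definition innerH (x y : H) : R[i] :=
  lim ((innerV (repr x i) (repr y i) : R[i]^o) @[i --> \oo]).

Definition normH (x : H) : R := Num.sqrt (complex.Re (innerH x x)).

Lemma const_cauchy (u : V R) : `[< cauchyV (fun=> u) >].
Proof.
apply/asboolP => e e0; exists 0%N => m n _ _.
by rewrite normV0.
Qed.

Definition mu (a : event) : H :=
  \pi_H (CauchySequence (const_cauchy (chi R a))).

Lemma amplV_repr (x : H) (u : cauchy_sequence) : x = \pi_H u ->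
  (amplV (repr x i) - amplV (u i) : R[i]^o) @[i --> \oo] --> (0 : R[i]^o).
Proof.
move=> ->; have /asboolP ru : equivb (repr (\pi_H u)) u.
  by rewrite -eqmodE reprK.
apply/cvgr0Pnorm_lt => e e0.
have [r er] : exists r : R, e = r%:C%C.
  by exists (complex.Re e); rewrite RRe_real // gtr0_real.
have r0 : 0 < r by rewrite -ltcR -er.
move: ru => /cvgr0Pnorm_lt/(_ _ r0); apply: filterS => i.
by rewrite ger0_norm ?sqrtr_ge0 // er -amplVB -normVE ltcR.
Qed.

Lemma innerH_mu (a b : event) : innerH (mu a) (mu b) = D a b.
Proof.
have L_chi c : amplV (chi R c) = ampl p q c.
  rewrite /amplV (@fsum_supp (chi R c) [:: c]) // ?big_seq1 /= /chi_fun ?eqxx ?mul1r //.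
    move=> d; rewrite /suppV in_fset_set ?inE /=.
      by case: (eqVneq d c) => [-> //|/negPf dc]; rewrite /chi_fun dc eqxx.
    exact: (asboolP _ (chi_finsupp R c)).
  by move=> d /= ->; rewrite mul0r.
have Lmu c : (amplV (repr (mu c) i) : R[i]^o) @[i --> \oo] --> (ampl p q c : R[i]^o).
  have /cvg_sub0 := amplV_repr (erefl (mu c)).
  rewrite /= L_chi; apply.
  exact: cvg_cst.
have Lmuc c : ((amplV (repr (mu c) i))^* : R[i]^o) @[i --> \oo] -->
    ((ampl p q c)^* : R[i]^o).
  apply/cvgrPdist_lt => e e0; move/cvgrPdist_lt: (Lmu c) => /(_ e e0).
  by apply: filterS => i; rewrite -rmorphB norm_conjC.
rewrite /innerH; under eq_fun do rewrite innerVE.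
apply: (@cvg_lim R[i]^o); first exact: norm_hausdorff.
exact: cvgM.
Qed.

Definition total_variation (m : event -> H) (a : event) : \bar R :=
  ereal_sup [set s : \bar R | exists (k : nat) (F : 'I_k -> event),
    partition [set: 'I_k] (fun i => set_val (F i)) (set_val a) /\
    s = (\sum_(i < k) normH (m (F i)))%:E].

Definition is_of_bounded_variation (m : event -> H) : Prop :=
  forall a : event, (total_variation m a < +oo)%E.

End HistoriesHilbertSpace.

(* Main.v *)
(* The children of a causal set C^n correspond to its down-sets D, with
   amplitude p^#max(D) q^(n - #D). If x is a maximal element of a set S, sorting
   the down-sets of S by whether they contain x expresses the sum W(S) of
   a^#max(D) b^#(S \ D) over them as
     W(S) = b W(S \ x) + a W(S \ ({x} u past x)).
   For (a, b) = (p, q) this gives W = 1, the additivity of the amplitude, and for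
   (a, b) = (|p|, |q|) it gives W(S) >= |p| + |q| when S is nonempty. Hence the
   norms of the amplitudes of the causal sets of size n + 1, whose cylinder sets
   partition Omega, add up to at least (|p| + |q|)^n; and |p| + |q| > 1 as p is
   not real. *)

From mathcomp Require Import all_boot all_order all_algebra.
From mathcomp Require Import complex boolp reals lra ring.
Require Import Defs.

Set Implicit Arguments.
Unset Strict Implicit.
Unset Printing Implicit Defensive.

Import Order.TTheory GRing.Theory Num.Theory.

Local Open Scope ring_scope.

(** * Down-sets of a finite causal set and their weighted sums *)

Section Causet.
Variables (n : nat) (C : causet n).
Implicit Types (i j k x y : 'I_n) (S D : {set 'I_n}).

Lemma prec_irr i : prec C i i = false.
Proof. by have /and3P[/forallP/(_ i)/negPf] := causetP C. Qed.

Lemma prec_trans j i k : prec C i j -> prec C j k -> prec C i k.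
Proof.
have /and3P[_ /forallP/(_ i)/forallP/(_ j)/forallP/(_ k) tr _] := causetP C.
by move=> ij jk; move: tr; rewrite -!/(prec C _ _) ij jk.
Qed.

Lemma prec_lt i j : prec C i j -> (i < j)%N.
Proof.
have /and3P[_ _ /forallP/(_ i)/forallP/(_ j) nat] := causetP C.
by move=> ij; move: nat; rewrite -!/(prec C _ _) ij.
Qed.

(** Closure is tested only inside [S]: removing an element together with its past can leave a set
    that is not down-closed in [C], and the recursion below passes through such sets. *)
Definition down_in S D : bool :=
  (D \subset S) && [forall i in D, forall j in S, prec C j i ==> (j \in D)].

(** When [D] is the past of a new element, these are the elements linked to it. *)
Definition tops D : {set 'I_n} := [set i in D | [forall k in D, ~~ prec C i k]].

Lemma down_inP S D :
  reflect (D \subset S /\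
      forall i j, i \in D -> j \in S -> prec C j i -> j \in D)
    (down_in S D).
Proof.
apply: (iffP andP) => -[sDS dD]; split=> //.
  move=> i j iD jS; move/forall_inP/(_ _ iD)/forall_inP/(_ _ jS)/implyP: dD.
  exact.
by apply/forall_inP => i iD; apply/forall_inP => j jS; apply/implyP; exact: dD.
Qed.

Lemma topsP D i :
  reflect (i \in D /\ forall k, k \in D -> prec C i k = false) (i \in tops D).
Proof.
rewrite inE; apply: (iffP andP) => -[iD ik]; split=> //.
  by move=> k kD; apply/negbTE; move/forall_inP: ik; exact.
by apply/forall_inP => k kD; rewrite ik.
Qed.

Section DownSum.
Variables (F : comNzRingType) (a b : F).

Definition down_sum S : F :=
  \sum_(D | down_in S D) a ^+ #|tops D| * b ^+ #|S :\: D|.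

Lemma down_sum0 : down_sum set0 = 1.
Proof.
rewrite /down_sum (big_pred1 set0); last first.
  move=> D; apply/down_inP/eqP => [[]|->]; first by rewrite subset0 => /eqP.
  by split=> // i j; rewrite inE.
rewrite setD0 cards0 (_ : tops set0 = set0) ?cards0 ?mulr1 //.
by apply/setP => i; rewrite !inE.
Qed.

(* Split the down-sets of S according to whether they contain x: those that do
   also contain the whole past of x. *)
Lemma down_sum_rec S x : x \in S -> (forall y, y \in S -> prec C x y = false) ->
  down_sum S =
    b * down_sum (S :\ x) + a * down_sum [set y in S :\ x | ~~ prec C y x].
Proof.
move=> xS xmax; pose S' := [set y in S :\ x | ~~ prec C y x].
rewrite /down_sum -/S' (bigID (fun D : {set 'I_n} => x \notin D)) /=.
congr (_ + _); rewrite big_distrr /=.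
- apply: eq_big => [D|D /andP[_ xD]].
    apply/andP/down_inP => [[/down_inP[sDS dD] xD]|[sDS dD]].
      split; first by rewrite subsetD1 sDS.
      by move=> i j iD /setD1P[_ jS]; exact: dD.
    have xD : x \notin D.
      by apply/negP => /(subsetP sDS); rewrite !inE eqxx.
    split=> //; apply/down_inP; split.
      by apply: subset_trans sDS _; exact: subsetDl.
    move=> i j iD jS ji; apply: (dD i) => //; rewrite !inE jS andbT.
    apply: contraTneq ji => ->; rewrite xmax //.
    by have /setD1P[] := subsetP sDS _ iD.
  rewrite (_ : #|S :\: D| = #|(S :\ x) :\: D|.+1) ?exprS; first by ring.
  rewrite (cardsD1 x) !inE xS xD /= add1n; congr _.+1; apply: eq_card => y.
  by rewrite !inE; case: (y == x); rewrite ?andbF.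
(* The down-sets containing [x] are in bijection with those of [S']: add [x] and its past in one
   direction, intersect with [S'] in the other. *)
rewrite (reindex_onto (fun D' => D' :|: (x |: [set y in S | prec C y x]))
  (fun D => D :&: S')) /=; last first.
  move=> D /andP[/down_inP[sDS dD]]; rewrite negbK => xD; apply/setP => y.
  rewrite !inE; have [->|yx] := eqVneq y x; first by rewrite orbT xD.
  have [yS|yS] := boolP (y \in S); last first.
    by rewrite !andbF orbF; apply/esym/negbTE; apply: contra yS; apply/subsetP.
  have [yx'|] := boolP (prec C y x); last by rewrite !andbT orbF.
  by rewrite orbT (dD x).
have UI D' : D' \subset S' ->
    (D' :|: (x |: [set y in S | prec C y x])) :&: S' = D'.
  move=> sD'; apply/setP => y; rewrite !inE.
  have [/(subsetP sD')|_] := boolP (y \in D'); first by rewrite !inE.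
  by case: (y == x) (prec C y x) => -[]; rewrite ?andbF.
apply: eq_big => [D'|D' /andP[_ /eqP defD']].
  apply/andP/down_inP => [[/andP[/down_inP[_ dD] _] /eqP defD']|[sD' dD']].
    split; first by rewrite -defD' subsetIr.
    move=> i j; rewrite -[D' in X in X -> _]defD' => /setIP[iD _] jS' ji.
    rewrite -defD' in_setI jS' andbT; apply: (dD i) => //.
    by move: jS'; rewrite !inE => /andP[/andP[]].
  rewrite UI //; split=> //; apply/andP; split; last first.
    by rewrite negbK !inE eqxx orbT.
  apply/down_inP; split.
    apply/subsetP => y; rewrite !inE.
    case/orP=> [/(subsetP sD')|/orP[/eqP->//|/andP[]//]].
    by rewrite !inE => /andP[/andP[]].
  move=> i j; rewrite !inE.
  case/orP=> [iD'|/orP[/eqP->|/andP[iS ix]]] jS ji; rewrite jS /=; last first.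
  - by rewrite (prec_trans ji ix) !orbT.
  - by rewrite ji !orbT.
  have [jx|jx] := boolP (prec C j x); first by rewrite !orbT.
  have [->|nxj] := eqVneq j x; first by rewrite orbT.
  by rewrite (dD' i) // !inE nxj jS.
have sD' : D' \subset S' by rewrite -defD' subsetIr.
have xD' : x \notin D' by apply/negP => /(subsetP sD'); rewrite !inE eqxx.
set D := D' :|: _.
(* Among the added elements only [x] is maximal, the others being below it. Elements of [D'] are not
   below [x], hence by transitivity not below its past, so maximality among them is unchanged. *)
have -> : tops D = x |: tops D'.
  apply/setP => y; rewrite in_setU1; apply/topsP/orP.
    move=> [yD ymax].
    have [->|yx] := eqVneq y x; [by left|right].
    have yx' : prec C y x = false by apply: ymax; rewrite !inE eqxx orbT.
    apply/topsP; split; first by move: yD; rewrite !inE (negPf yx) yx' andbF !orbF.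
    by move=> k kD'; apply: ymax; rewrite !inE kD'.
  case=> [/eqP->|/topsP[yD' ymax]].
    split; first by rewrite !inE eqxx orbT.
    move=> k; rewrite !inE => kD; apply: xmax.
    case/orP: kD => [/(subsetP sD')|/orP[/eqP->//|/andP[]//]].
    by rewrite !inE => /andP[/andP[]].
  split; first by rewrite !inE yD'.
  have /negbTE yx : ~~ prec C y x.
    by have := subsetP sD' _ yD'; rewrite !inE => /andP[].
  move=> k; rewrite !inE => /orP[/ymax//|/orP[/eqP->//|/andP[_ kx]]].
  by apply/negbTE; apply/negP => /prec_trans/(_ kx); rewrite yx.
have -> : S :\: D = S' :\: D'.
  apply/setP => y; rewrite !inE.
  by case: (y \in S) (y \in D') (y == x) (prec C y x) => -[] [] [].
rewrite cardsU1 (_ : x \notin tops D').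
  by rewrite exprD expr1 mulrA.
by apply/topsP => -[]; rewrite (negPf xD').
Qed.

(** The element with the largest label is maximal, because relations increase labels. *)
Lemma exists_maximal S : S != set0 ->
  exists2 x, x \in S & forall y, y \in S -> prec C x y = false.
Proof.
case/set0Pn=> x0 x0S; case: (arg_maxnP (fun x : 'I_n => x : nat) x0S) => x xS xmax.
exists x => // y yS; apply/negbTE/negP => /prec_lt.
by rewrite ltnNge; move: (xmax y yS) => /= ->.
Qed.

(** Strong induction on [#|S|]: both sets on the right of [down_sum_rec] lack [x]. It serves for the
    exact value 1 and for the lower bound 1. *)
Lemma down_sum_ind (P : F -> Prop) S : P 1 ->
  (forall s t, P s -> P t -> P (b * s + a * t)) -> P (down_sum S).
Proof.
move=> P1 Pab; have [m] := ubnP #|S|; elim: m S => // m IH S Sm.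
have [->|/exists_maximal[x xS xmax]] := eqVneq S set0; first by rewrite down_sum0.
rewrite (down_sum_rec xS xmax).
have lt_m : (#|S :\ x| < m)%N by rewrite (cardsD1 x S) xS in Sm.
apply: Pab; apply: IH => //; apply: leq_ltn_trans lt_m.
by apply: subset_leq_card; apply/subsetP => y; rewrite inE => /andP[].
Qed.

Lemma down_sum1 S : a + b = 1 -> down_sum S = 1.
Proof.
by move=> ab; apply: (@down_sum_ind (eq^~ 1)) => // s t -> ->; rewrite !mulr1 addrC.
Qed.

End DownSum.

(** Every weighted sum is at least 1 by induction; one more use of the recursion, possible as [S] is
    nonempty, gives [a + b]. *)
Lemma down_sum_ge (F : numDomainType) (a b : F) S : 0 <= a -> 0 <= b ->
  1 <= a + b -> S != set0 -> a + b <= down_sum a b S.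
Proof.
move=> a0 b0 ab /exists_maximal[x xS xmax].
have ge1 T : 1 <= down_sum a b T.
  apply: (@down_sum_ind _ _ _ (>= 1)) => // s t s1 t1; apply: le_trans ab _; rewrite addrC.
  by apply: lerD; rewrite ler_peMr.
by rewrite (down_sum_rec _ _ xS xmax) addrC; apply: lerD; rewrite ler_peMr.
Qed.

End Causet.

(** * Children of a causal set correspond to its down-sets *)

Section Children.
Variable n : nat.
Implicit Types (C : causet n) (D : causet n.+1) (P : {set 'I_n}).

Lemma widen_ord_lift (i : 'I_n) : widen_ord (leqnSn n) i = lift ord_max i.
Proof. by apply: ord_inj; rewrite lift_max. Qed.

Lemma prec_restrict D i j :
  prec (restrict D) i j = prec D (lift ord_max i) (lift ord_max j).
Proof. by rewrite /prec inE /= !widen_ord_lift. Qed.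

Lemma prec_maxl D i : prec D ord_max i = false.
Proof. by apply/negbTE/negP => /prec_lt; rewrite ltnNge -ltnS ltn_ord. Qed.

Definition past_max D : {set 'I_n} := [set i | prec D (lift ord_max i) ord_max].

Definition child_rel C P : {set 'I_n.+1 * 'I_n.+1} :=
  [set x | match unlift ord_max x.1, unlift ord_max x.2 with
           | Some i, Some j => prec C i j
           | Some i, None => i \in P
           | None, _ => false
           end].

(** Down-closure of [P] is what transitivity demands of a chain ending at the new element. *)
Lemma child_causet C P : down_in C [set: 'I_n] P ->
  is_causet (fun i j => (i, j) \in child_rel C P).
Proof.
move=> /down_inP[_ dP]; apply/and3P; split; apply/forallP => i.
- by rewrite inE /=; case: unliftP => // i' _; rewrite prec_irr.
- apply/forallP => j; apply/forallP => k; rewrite !inE /=.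
  apply/implyP; case: unliftP => // i' _; case: unliftP => // j' _ ij.
  apply/implyP; case: unliftP => [k'|] _; first exact: prec_trans ij.
  by move=> jP; apply: dP ij => //; rewrite inE.
- apply/forallP => j; rewrite !inE /=; apply/implyP.
  case: unliftP => // i' ->; case: unliftP => [j'|] -> ij; rewrite !lift_max //.
  exact: prec_lt ij.
Qed.

Lemma down_past_max D : down_in (restrict D) [set: 'I_n] (past_max D).
Proof.
apply/down_inP; split=> [|i j]; first exact: subsetT.
by rewrite !inE prec_restrict => iM _ ji; exact: prec_trans iM.
Qed.

Lemma causet_inj (m : nat) (C1 C2 : causet m) :
  (forall i j, prec C1 i j = prec C2 i j) -> C1 = C2.
Proof. by move=> eqC; apply: val_inj; apply/setP => -[i j]; exact: eqC. Qed.

(** With [past_max_image], this makes [past_max] a bijection from the children of [C] to its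
    down-sets, which turns sums over children into [down_sum]. *)
Lemma past_max_inj C : {in [set D | restrict D == C] &, injective past_max}.
Proof.
move=> D1 D2; rewrite !inE => /eqP D1C /eqP D2C eqP.
apply: causet_inj => i j.
case: (unliftP ord_max i) => [i'|] ->; last by rewrite !prec_maxl.
case: (unliftP ord_max j) => [j'|] ->; first by rewrite -!prec_restrict D1C D2C.
by move/setP/(_ i'): eqP; rewrite !inE.
Qed.

Lemma past_max_image C :
  past_max @: [set D | restrict D == C] = [set P | down_in C [set: 'I_n] P].
Proof.
apply/setP => P; rewrite inE; apply/imsetP/idP => [[D]|dP].
  by rewrite inE => /eqP <- ->; exact: down_past_max.
exists (Causet (child_causet dP)).
  rewrite inE; apply/eqP; apply: causet_inj => i j.
  by rewrite prec_restrict /prec inE /= !liftK.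
by apply/setP => i; rewrite inE /prec inE /= liftK unlift_none.
Qed.

Lemma card_lift (A : {set 'I_n}) (B : {pred 'I_n.+1}) : ord_max \notin B ->
  (forall i, (lift ord_max i \in B) = (i \in A)) -> #|B| = #|A|.
Proof.
move=> mB AB; rewrite -(card_imset A (@lift_inj _ ord_max)).
apply: eq_card => i; case: (unliftP ord_max i) => [j|] ->.
  by rewrite mem_imset ?AB //; exact: lift_inj.
by rewrite (negPf mB); apply/esym/imsetP => -[j _ /eqP]; rewrite eq_liftF.
Qed.

(** An element strictly between [i] and the new element is an element of its past above [i], so
    being linked to the new element means being maximal in its past. *)
Lemma card_linked_max D :
  #|[pred i | linked D i ord_max]| = #|tops (restrict D) (past_max D)|.
Proof.
apply: card_lift => [|i]; first by rewrite inE /linked /related prec_irr.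
rewrite !inE /linked /related prec_maxl orbF; congr (_ && _).
rewrite negb_exists; apply/forallP/forall_inP => [ik k|ik k].
  rewrite inE prec_restrict => kM; have := ik (lift ord_max k).
  by rewrite prec_maxl kM orbF andbT.
rewrite prec_maxl orbF; apply/negP => /andP[].
case: (unliftP ord_max k) => [k'|] -> ik' kM; last by rewrite prec_irr in kM.
by have := ik k'; rewrite inE kM prec_restrict ik' => /(_ isT).
Qed.

Lemma card_unrelated_max D :
  #|[pred i | (i != ord_max) && ~~ related D i ord_max]| =
  #|[set: 'I_n] :\: past_max D|.
Proof.
apply: card_lift => [|i]; first by rewrite inE eqxx.
by rewrite !inE /related prec_maxl orbF andbT eq_sym neq_lift.
Qed.

Lemma sum_children (F : comNzRingType) (a b : F) C :
  \sum_(D | restrict D == C)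
    a ^+ #|tops C (past_max D)| * b ^+ #|[set: 'I_n] :\: past_max D| =
  down_sum C a b [set: 'I_n].
Proof.
rewrite /down_sum -[RHS]big_set -past_max_image (big_imset _ (@past_max_inj C)).
by rewrite [RHS]big_set.
Qed.

End Children.

(** * Sums of transition amplitudes and of their norms *)

Section Amplitude.
Variables (R : realType) (p q : R[i]).
Hypothesis pq1 : p + q = 1.

Lemma transitionE n (D : causet n.+1) :
  transition p q D = p ^+ #|tops (restrict D) (past_max D)| *
    q ^+ #|[set: 'I_n] :\: past_max D|.
Proof.
rewrite -card_linked_max -card_unrelated_max /transition.
(* [transition] counts classical sets, whose membership is an [asbool]. *)
by congr (_ ^+ _ * _ ^+ _); apply: eq_card => i; exact: asboolb.
Qed.

Lemma sum_transition n (C : causet n) :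
  \sum_(D | restrict D == C) transition p q D = 1.
Proof.
rewrite -(down_sum1 C [set: _] pq1) -sum_children.
by apply: eq_bigr => D /eqP <-; exact: transitionE.
Qed.

Lemma sum_norm_transition n (C : causet n) : (0 < n)%N ->
  `|p| + `|q| <= \sum_(D | restrict D == C) `|transition p q D|.
Proof.
move=> n0.
have -> : \sum_(D | restrict D == C) `|transition p q D| =
    down_sum C `|p| `|q| [set: 'I_n].
  rewrite -sum_children; apply: eq_bigr => D /eqP <-.
  by rewrite transitionE normrM !normrX.
apply: down_sum_ge => //; first by rewrite -[leLHS]normr1 -pq1 ler_normD.
by apply/set0Pn; exists (Ordinal n0); rewrite inE.
Qed.

Lemma sum_norm_amplitude n :
  (`|p| + `|q|) ^+ n <= \sum_(C : causet n.+1) `|amplitude p q C|.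
Proof.
elim: n => [|n IH].
  (* The induction starts at size 1, since growth from the empty causal set gives no factor
     [|p| + |q|]; there the amplitudes sum to 1, and so the norms to at least 1. *)
  rewrite expr0; apply: le_trans (ler_norm_sum _ _ _).
  rewrite (eq_bigr (@transition R p q 0)); last by move=> C _; rewrite /= mul1r.
  rewrite (partition_big (@restrict 0) xpredT) //=.
  under eq_bigr do rewrite sum_transition.
  have emptyP : is_causet (fun i j : 'I_0 => (i, j) \in set0).
    by apply/and3P; split; apply/forallP => -[].
  rewrite (big_pred1 (Causet emptyP)) ?normr1 // => C; apply/esym/eqP.
  by apply: causet_inj => -[].
rewrite (partition_big (@restrict n.+1) xpredT) //= exprSr.
apply: le_trans (ler_wpM2r _ IH) _; first by rewrite addr_ge0.
rewrite mulr_suml; apply: ler_sum => C _.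
apply: le_trans (ler_wpM2l _ (sum_norm_transition C (ltn0Sn n))) _ => //.
rewrite mulr_sumr; apply: ler_sum => D /eqP <-.
by rewrite -normrM.
Qed.

End Amplitude.

(** The real parts of [p] and [q] add up to 1; each is at most the norm, strictly so for [p], whose
    imaginary part is nonzero. *)
Lemma normD_gt1 (R : realType) (p q : R[i]) :
  p + q = 1 -> p \isn't Num.real -> 1 < `|p| + `|q|.
Proof.
move=> /eqP; rewrite addrC eq_sym -subr_eq => /eqP <-; case: p => x y.
rewrite complex_real /= => y0.
have xlt : x < Num.sqrt (x ^+ 2 + y ^+ 2).
  apply: le_lt_trans (ler_norm x) _; rewrite -sqrtr_sqr ltr_sqrt.
    by rewrite ltrDl exprn_even_gt0.
  by rewrite ltr_wpDl ?sqr_ge0 // exprn_even_gt0.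
have xle : 1 - x <= Num.sqrt ((1 - x) ^+ 2 + (0 - y) ^+ 2).
  apply: le_trans (ler_norm _) _; rewrite -sqrtr_sqr ler_wsqrtr //.
  by rewrite lerDl sqr_ge0.
rewrite !normc_def /= -rmorphD (ltcR 1).
by lra.
Qed.

From mathcomp Require Import all_classical all_analysis.

Local Open Scope classical_set_scope.

(** * Truncations of infinite causal sets, and cylinder sets *)

Definition trunc n (c : Omega) : {set 'I_n * 'I_n} :=
  [set x : 'I_n * 'I_n | `[< c x.1 x.2 >]].

Lemma trunc_causet n c : is_causet (fun i j => (i, j) \in trunc n c).
Proof.
apply/and3P; split; apply/forallP => i.
- by rewrite inE; apply/asboolP; exact: oprec_irr.
- apply/forallP => j; apply/forallP => k; rewrite !inE.
  by apply/implyP => /asboolP ij; apply/implyP => /asboolP jk;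
    apply/asboolP; exact: oprec_trans jk.
- apply/forallP => j; rewrite inE; apply/implyP => /asboolP.
  exact: oprec_natural.
Qed.

Definition truncation n c : causet n := Causet (trunc_causet n c).

Lemma prec_truncation n c i j : prec (truncation n c) i j <-> c i j.
Proof. by rewrite /prec inE; split => [/asboolP|?]; last exact/asboolP. Qed.

Lemma cylP n (C : causet n) c : cyl C c <-> truncation n c = C.
Proof.
split=> [cC|<- i j]; last by rewrite prec_truncation.
apply: causet_inj => i j; apply/idP/idP.
  by move/prec_truncation/cC.
by move/cC/prec_truncation.
Qed.

Lemma restrict_truncation n c : Defs.restrict (truncation n.+1 c) = truncation n c.
Proof.
apply: causet_inj => i j; rewrite prec_restrict.
by apply/idP/idP => /prec_truncation cij; apply/prec_truncation;
  move: cij; rewrite !lift_max.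
Qed.

Lemma truncation_le m n c c' : (m <= n)%N ->
  truncation n c = truncation n c' -> truncation m c = truncation m c'.
Proof.
elim: n => [|n IH]; first by rewrite leqn0 => /eqP->.
rewrite leq_eqVlt => /predU1P[->//|/IH {}IH eqc]; apply: IH.
by move/(congr1 (@Defs.restrict n)): eqc; rewrite !restrict_truncation.
Qed.

Section Isolated.
Variables (n : nat) (C : causet n).

(** All labels from [n] on are unrelated to everything. This provides a point in every cylinder
    set. *)
Definition isolated_prec (i j : nat) : Prop :=
  exists i' j' : 'I_n, [/\ i' = i :> nat, j' = j :> nat & prec C i' j'].

Lemma isolated_irr i : ~ isolated_prec i i.
Proof.
by move=> [i1 [i2 [<- /ord_inj ->]]]; rewrite prec_irr.
Qed.

Lemma isolated_trans i j k :
  isolated_prec i j -> isolated_prec j k -> isolated_prec i k.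
Proof.
move=> [i1 [j1 [<- <- ij]]] [j2 [k2 [/ord_inj ej <- jk]]].
by exists i1, k2; split=> //; apply: prec_trans ij _; rewrite -ej.
Qed.

Lemma isolated_natural i j : isolated_prec i j -> (i < j)%N.
Proof. by move=> [i1 [j1 [<- <-]]]; exact: prec_lt. Qed.

Definition isolated_extension : Omega :=
  MkOmega isolated_irr isolated_trans isolated_natural.

Lemma truncation_isolated : truncation n isolated_extension = C.
Proof.
apply: causet_inj => i j; apply/idP/idP.
  by move/prec_truncation => [i1 [j1 [/ord_inj -> /ord_inj ->]]].
by move=> ij; apply/prec_truncation; exists i, j.
Qed.

End Isolated.

Lemma cyl_in_algebra n (C : causet n) : cyl_algebra (cyl C).
Proof.
exists [:: Tagged causet C].
by apply/seteqP; split=> [c cC|c [D /=]];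
  [exists (Tagged causet C); rewrite //= inE | rewrite inE => /eqP ->].
Qed.

Definition cyl_event n (C : causet n) : event :=
  exist _ (cyl C) (mem_set (cyl_in_algebra C)).

(** * The amplitude of a cylinder event *)

Section Ampl.
Variables (R : realType) (p q : R[i]).
Hypothesis pq1 : p + q = 1.

(** Group the causal sets of size [n.+1] by their restriction and use that transitions sum to 1.
    Truncating the isolated extension restricts [D] to its first [m] elements without casts between
    sizes. *)
Lemma sum_amplitude_extensions m n (C : causet m) : (m <= n)%N ->
  \sum_(D : causet n | truncation m (isolated_extension D) == C)
    amplitude p q D = amplitude p q C.
Proof.
elim: n => [|n IH].
  rewrite leqn0 => /eqP m0; subst m.
  by apply: big_pred1 => D; rewrite truncation_isolated.
rewrite leq_eqVlt => /predU1P[m_n|/[!ltnS] le_mn].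
  by subst m; apply: big_pred1 => D; rewrite truncation_isolated.
rewrite (partition_big (@Defs.restrict n)
  (fun D => truncation m (isolated_extension D) == C)) /=; last first.
  move=> D /eqP <-; apply/eqP; apply: (truncation_le le_mn).
  by rewrite truncation_isolated -restrict_truncation truncation_isolated.
rewrite -(IH le_mn); apply: eq_bigr => D /eqP DC.
rewrite -[RHS]mulr1 -(sum_transition pq1 D) mulr_sumr; apply: eq_big => D'.
  case: (Defs.restrict D' =P D) => [DD'|]; rewrite ?andbF ?andbT //.
  apply/eqP; rewrite -DC -DD'; apply: (truncation_le le_mn).
  by rewrite truncation_isolated -restrict_truncation truncation_isolated.
by move=> /andP[_ /eqP <-].
Qed.

(* Refine all the cylinder sets of a decomposition to a common size N. *)
Lemma ampl_cyl n (C : causet n) : ampl p q (cyl_event C) = amplitude p q C.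
Proof.
rewrite /ampl /=; set s := xget _ _.
have [s_uniq [s_cover s_triv _]] : decomposition (cyl C) s.
  apply: (@xgetPex _ _ (decomposition (cyl C))).
  (* The one-member decomposition ensures that [xget] returns a genuine decomposition and not its
     default. *)
  exists [:: Tagged causet C]; split=> //; split.
  - by apply/seteqP; split=> [c [D /=]|c cC];
      [rewrite inE => /eqP -> | exists (Tagged causet C); rewrite //= inE].
  - by move=> D1 D2 /=; rewrite !inE => /eqP -> /eqP ->.
  - move=> D /=; rewrite inE => /eqP ->; exists (isolated_extension C).
    by apply/cylP; exact: truncation_isolated.
pose N := maxn n (\max_(D <- s) tag D).
have le_N D : D \in s -> (tag D <= N)%N.
  by move=> Ds; rewrite leq_max; apply/orP; right; exact: leq_bigmax_seq.
rewrite -(sum_amplitude_extensions C (leq_maxl n _ : n <= N)%N).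
transitivity (\sum_(E <- s) \sum_(D : causet N |
    truncation (tag E) (isolated_extension D) == tagged E) amplitude p q D).
  rewrite !big_seq; apply: eq_bigr => E Es.
  by rewrite sum_amplitude_extensions ?le_N.
(* It remains to count, for each [D], the members of [s] whose cylinder set contains
   [isolated_extension D]: one if this point lies in [cyl C], none otherwise. *)
rewrite (exchange_big_dep xpredT) //= [RHS]big_mkcond; apply: eq_bigr => D _.
set c := isolated_extension D.
have cs E : E \in s -> truncation (tag E) c == tagged E -> cyl C c.
  by move=> Es /eqP/cylP cE; rewrite -s_cover; exists E.
case: eqP => [/cylP|/cylP nCc]; last first.
  by rewrite big_seq_cond big1 // => E /andP[Es /(cs _ Es)].
rewrite -s_cover => -[E0 /= E0s cE0].
rewrite (big_rem E0) //= (introT eqP ((cylP _ _).1 cE0)) big_seq_cond big1 ?addr0 //.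
move=> E /andP[+ /eqP/cylP cE]; rewrite mem_rem_uniq // inE => /andP[/eqP neE Es].
by case: neE; apply: s_triv => //; exists c.
Qed.

Lemma normH_mu (a : event) : (normH (mu p q a))%:C%C = `|ampl p q a|.
Proof.
rewrite /normH innerH_mu /decoherence mulrC -normCK normc_def.
rewrite -rmorphXn /= [Num.sqrt (_ ^+ 2)]sqrtr_sqr ger0_norm //.
Qed.

End Ampl.


(** * Unbounded variation over the whole of [Omega] *)

Lemma empty_causet : is_causet (fun i j => (i, j) \in (finset.set0 : {set 'I_0 * 'I_0})).
Proof. by apply/and3P; split; apply/forallP => -[]. Qed.

Lemma cyl0 (C : causet 0) : cyl C = setT.
Proof. by apply/seteqP; split=> // c _ -[]. Qed.

(** The cylinder sets of size [n] partition [Omega], which enters as the cylinder set of the empty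
    causal set. *)
Lemma total_variation_cylinders (R : realType) (p q : R[i])
    (m : event -> H p q) n (C0 : causet 0) :
  ((\sum_(C : causet n) normH (m (cyl_event C)))%:E <=
    Defs.total_variation m (cyl_event C0))%E.
Proof.
apply: ereal_sup_ubound => /=.
exists #|{: causet n}|, (fun i => cyl_event (enum_val i)); split; last first.
  by rewrite -(big_enum_val (fun C => normH (m (cyl_event C)))).
have -> : set_val (cyl_event C0) = setT by exact: cyl0.
split.
- apply/seteqP; split=> // c _.
  exists (enum_rank (truncation n c)) => //=.
  by rewrite enum_rankK; apply/cylP.
- move=> i j _ _ [c [/cylP ci /cylP cj]].
  by apply: enum_val_inj; rewrite -ci -cj.
- move=> i _; exists (isolated_extension (enum_val i)).
  by apply/cylP; exact: truncation_isolated.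
Qed.

(** Bernoulli's inequality and the Archimedean property. *)
Lemma exprn_unbounded (R : realType) (c M : R) : 1 < c -> exists n, M < c ^+ n.
Proof.
move=> c1.
have bern n : 1 + (c - 1) *+ n <= c ^+ n.
  elim: n => [|n IH]; first by rewrite expr0 addr0.
  rewrite exprS; apply: le_trans (ler_wpM2l _ IH); last by lra.
  have : 0 <= (c - 1) * ((c - 1) *+ n).
    by rewrite mulr_ge0 ?mulrn_wge0 // subr_ge0 ltW.
  by rewrite mulrSr; move: ((c - 1) *+ n) => t; lra.
exists (Num.bound (`|M| / (c - 1))); apply: lt_le_trans (bern _).
have := archi_boundP (divr_ge0 (normr_ge0 M) (ltW (_ : 0 < c - 1))).
rewrite subr_gt0 ltr_pdivrMr ?subr_gt0 // mulr_natl => /(_ c1).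
by move: (ler_norm M) (_ *+ _) => M_le t; lra.
Qed.

Theorem lemma1 (R : realType) (p q : R[i]) :
  p + q = 1 -> p \isn't Num.real -> ~ is_of_bounded_variation (mu p q).
Proof.
move=> pq1 p_nonreal bv; pose C0 := Causet empty_causet.
(* Norms in [R[i]] are complex numbers; the comparison with the total variation needs the real value
   [c]. *)
have [c] : exists c, `|p| + `|q| = c%:C%C.
  by rewrite !normc_def -rmorphD /=; eexists.
move=> pqc; have := normD_gt1 pq1 p_nonreal; rewrite pqc (ltcR 1) => c1.
have := bv (cyl_event C0).
have := total_variation_cylinders (mu p q) _ C0.
have tv n : c ^+ n <= \sum_(C : causet n.+1) normH (mu p q (cyl_event C)).
  rewrite -lecR rmorphXn /= -pqc rmorph_sum /=.
  apply: le_trans (sum_norm_amplitude pq1 n) _.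
  by apply: ler_sum => C _; rewrite normH_mu ampl_cyl.
case: Defs.total_variation => [M| |] //.
  move=> le_M _; have [n] := exprn_unbounded M c1.
  by rewrite ltNge (le_trans (tv n)) // -lee_fin.
(* The value [-oo] remains: it cannot bound a real sum from above. *)
by move=> /(_ 0%N).
Qed.
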